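(* Let $F$ be a surjective closed relation on a compact metric space $X$ and let $C$ be an isolating neighborhood for $F$. If $C_{+}$ and $C_-$ are nowhere dense subsets of $C$, then for any $\epsilon > 0$ there exists a surjective closed relation $\hat G$ on $X$ such that $\hat G \subset V_{\epsilon} \circ F$ and $F \subset V_{\epsilon} \circ \hat G$, but such that there exists a positive integer $N$ with $(\hat G_C)^N = \emptyset$. In particular, with respect to $\hat G$ we have $C_- = C_+ = C_{\pm} = \emptyset$.
   Context: A relation $F$ on $X$ is a subset of $X\times X$, closed if it is a closed subset; $F(x)=\{y:(x,y)\in F\}$, $F(A)=\bigcup_{x\in A}F(x)$, $F^{-1}=\{(y,x):(x,y)\in F\}$, $G\circ F=\{(x,z): \exists y,\ (x,y)\in F, (y,z)\in G\}$; $F^n$ is the $n$-fold composition, $F^{-n}=(F^{-1})^n$. $F$ is surjective if $F(X)=X$ and $F^{-1}(X)=X$, i.e. $F(x)\ne\emptyset\neq F^{-1}(x)$ for all $x\in X$. $V_\epsilon=\{(x,y)\in X\times X:d(x,y)<\epsilon\}$. For a closed relation $F$ and closed $C\subset X$: $F_C=F\cap(C\times C)$; $C_-=\bigcap_{n\ge1}(F_C)^n(C)$, $C_+=\bigcap_{n\ge1}(F_C)^{-n}(C)$, $C_\pm=C_+\cap C_-$. The closed set $C$ is an isolating neighborhood for $F$ if $C_\pm$ is contained in the interior of $C$ in $X$. ''Nowhere dense subset of $C$'' is with respect to the relative topology of $C$. *)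

(* Defs.v *)
From HB Require Import structures.
From mathcomp Require Import all_boot all_order all_algebra.
From mathcomp Require Import all_classical all_reals.
From mathcomp Require Import topology_structure pseudometric_structure.
From mathcomp Require Import product_topology compact subspace_topology.
From mathcomp Require Import metric_structure.

Set Implicit Arguments.
Unset Strict Implicit.
Unset Printing Implicit Defensive.

Local Open Scope classical_set_scope.

(* [relation_scope] notations: [G \; F] is G o F ("first F, then G"), and
   [F^-1] is the converse relation. *)

Section Relations.
Context {X : Type}.
Implicit Types (F : set (X * X)) (A C : set X) (x : X) (n : nat).

Definition rel_at F x : set X := [set y | F (x, y)].

Definition rel_image F A : set X := \bigcup_(x in A) rel_at F x.

Definition rel_pow F n : set (X * X) :=
  iter n (fun H => (F \; H)%relation) [set p | p.1 = p.2].

Definition surjective_rel F : Prop :=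
  rel_image F setT = setT /\ rel_image (F^-1)%relation setT = setT.

Definition rel_restrict F C : set (X * X) := F `&` (C `*` C).

Definition C_minus F C : set X :=
  \bigcap_(n in [set n | (1 <= n)%N]) rel_image (rel_pow (rel_restrict F C) n) C.

Definition C_plus F C : set X :=
  \bigcap_(n in [set n | (1 <= n)%N])
    rel_image (rel_pow ((rel_restrict F C)^-1)%relation n) C.

Definition C_pm F C : set X := C_plus F C `&` C_minus F C.

End Relations.

Definition isolating_nbhd {X : topologicalType} (F : set (X * X)) (C : set X) :
    Prop :=
  closed C /\ C_pm F C `<=` interior C.

Definition nowhere_dense {T : topologicalType} (A : set T) : Prop :=
  interior (closure A) = set0.

(* [subspace C] is the type X in which the points outside C are made isolated;
   for A included in C, the closure and interior below are therefore the ones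
   of the relative topology of C. *)
Definition nowhere_dense_subset {X : topologicalType} (C A : set X) : Prop :=
  A `<=` C /\ nowhere_dense (A : set (subspace C)).

Definition V_ {R : realType} {X : metricType R} (eps : R) : set (X * X) :=
  [set p | (mdist p.1 p.2 < eps)%R].

(* Main.v *)
Require Import Defs.
From HB Require Import structures.
From mathcomp Require Import all_boot all_order all_algebra.
From mathcomp Require Import all_classical all_reals.
From mathcomp Require Import topology_structure pseudometric_structure.
From mathcomp Require Import product_topology compact subspace_topology.
From mathcomp Require Import metric_structure.
From mathcomp Require Import filter separation_axioms.

(** Why the theorem is true.  Write F_C for F restricted to C, and call a finite
    sequence of F_C-steps an orbit.  Long orbits in C start near C_+, end near
    C_-, and all of their middle steps go from a neighborhood S of C_+ to a
    neighborhood T of C_-.  So it is enough to destroy the steps of F from S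
    to T, and keep the others; a bounded number of consecutive kept steps then
    leads out of C.  The destroyed steps have to be replaced by nearby ones,
    because every point must keep an image and a preimage.  Two kinds of steps
    do this:

    - entries, which give images: if x is in S and y is in F(x) and in T, then
      the target y moves to a nearby point d of a finite set D;
    - exits, which give preimages: a point z of T receives a step from a
      chosen F-preimage pre(e) of a nearby point e of a finite set E.

    As C_- is nowhere dense, E can be taken in C and off C_-, so that backward
    orbits from pre(E) have bounded length.  Their points form a compact set
    Km that misses C_-, and T is chosen disjoint from Km.  As C_+ is nowhere
    dense, D can then be taken off both C_+ and Km.  Forward orbits from D have
    bounded length, their points form a compact set K that misses C_+, and S is
    chosen disjoint from K ([barrier] makes both choices, the first for F^-1).
    Now an orbit that has just made an entry lies in K but not in Km; there
    only kept steps are possible, so there is no entry or exit any more.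
    Symmetrically, an orbit that is about to make an exit lies in Km, which
    neither an entry nor an exit can reach, so all of its earlier steps were
    kept.  Hence an orbit makes at most one exit and then at most one entry,
    and between them only bounded runs of kept steps ([no_long_orbit]).

    The order of the choices E, T, D, S matters: each set has to avoid a compact
    set that the previous ones determine. *)

Set Implicit Arguments.
Unset Strict Implicit.
Unset Printing Implicit Defensive.

Import Order.TTheory GRing.Theory Num.Theory.

Local Open Scope classical_set_scope.

(** * Orbits of a relation and limit sets *)

Section Orbits.
Context {X : Type}.
Implicit Types (F H : set (X * X)) (A B C : set X).

Definition orbit H n (u : nat -> X) := forall i, (i < n)%N -> H (u i, u i.+1).

Lemma orbit_shift H m n u : orbit H (m + n)%N u -> orbit H n (fun i => u (m + i)%N).
Proof. by move=> ou i ltin; rewrite addnS; apply: ou; rewrite ltn_add2l. Qed.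

Lemma orbit_take H m n u : (m <= n)%N -> orbit H n u -> orbit H m u.
Proof. by move=> lemn ou i ltim; apply/ou/(leq_trans ltim). Qed.

Lemma rel_pow_orbit H n x y :
  rel_pow H n (x, y) -> exists u, [/\ u 0%N = x, u n = y & orbit H n u].
Proof.
elim: n y => [|n IHn] y /=; first by move=> ->; exists (fun=> y); split.
case=> z /IHn [u [u0 un ou]] /= Hzy.
exists (fun i => if (i <= n)%N then u i else y); split; rewrite ?ltnn //.
move=> i; rewrite ltnS; case: ltngtP => // [ltin|->] _; first exact: ou.
by rewrite un.
Qed.

Lemma rel_pow_eq0 H n : (forall u, ~ orbit H n u) -> rel_pow H n = set0.
Proof. by move=> H0; rewrite -subset0 => -[x y] /rel_pow_orbit[u [_ _ /H0]]. Qed.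

Lemma rel_image_pow H n A :
  rel_image (rel_pow H n) A = iter n (rel_image H) A.
Proof.
elim: n => [|n IHn] /=.
  by rewrite predeqE => y; split=> [[x Ax] <-|Ay] //; exists y.
rewrite -IHn predeqE => y; split.
  by case=> x Ax [z /= xz zy]; exists z => //; exists x.
by case=> z [x Ax xz] zy; exists x => //; exists z.
Qed.

Lemma meet_rel_image H A B :
  rel_image H A `&` B !=set0 <-> A `&` rel_image (H^-1)%relation B !=set0.
Proof.
split=> [[y [[x Ax xy] By]]|[x [Ax [y By /= xy]]]].
  by exists x; split=> //; exists y.
by exists y; split=> //; exists x.
Qed.

(** Both sides say that some orbit of length n leads from A to B.  This turns
    statements about forward images into statements about the sets whose
    intersection is [C_plus]. *)
Lemma meet_iter_rel_image H n A B :
  iter n (rel_image H) A `&` B !=set0 <->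
  A `&` iter n (rel_image (H^-1)%relation) B !=set0.
Proof.
elim: n A B => [//|n IHn] A B.
by rewrite iterS iterSr meet_rel_image; apply: IHn.
Qed.

Lemma relV_involutive H : ((H^-1)^-1)%relation = H.
Proof. by rewrite predeqE => -[]. Qed.

Lemma rel_restrictV F C :
  rel_restrict (F^-1)%relation C = ((rel_restrict F C)^-1)%relation.
Proof.
by rewrite predeqE => -[x y]; rewrite /rel_restrict /=; split=> -[? []].
Qed.

Lemma C_minusV F C : C_minus F C = C_plus (F^-1)%relation C.
Proof. by rewrite /C_plus rel_restrictV relV_involutive. Qed.

Lemma C_plus_sub F C : C_plus F C `<=` C.
Proof. by move=> x /(_ 1%N isT) [y _ [z _ [_ []]]]. Qed.

Lemma C_minus_sub F C : C_minus F C `<=` C.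
Proof. by rewrite C_minusV; apply: C_plus_sub. Qed.

(** Prolonging backward orbits of x by the step to y; the index n = 1 of the
    intersection is special, as C itself is not one of the sets that define
    [C_minus]. *)
Lemma C_minus_image F C x y :
  C_minus F C x -> C y -> F (x, y) -> C_minus F C y.
Proof.
move=> Mx Cy Fxy [//|n] _; have Cx := C_minus_sub Mx.
rewrite rel_image_pow /=; exists x; last by split.
case: n => [|n]; first exact: Cx.
by rewrite -rel_image_pow; apply: Mx.
Qed.

Lemma nilpotent_limit_sets F C N : (0 < N)%N ->
  rel_pow (rel_restrict F C) N = set0 -> C_minus F C = set0 /\ C_plus F C = set0.
Proof.
move=> N0 FN0.
have itN A : iter N (rel_image (rel_restrict F C)) A = set0.
  by rewrite -rel_image_pow FN0 -subset0 => y [x].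
split; rewrite -subset0 => x /(_ N N0); rewrite rel_image_pow ?itN // => Cx.
have [y] : iter N (rel_image (rel_restrict F C)) setT `&` C !=set0.
  by apply/meet_iter_rel_image; exists x.
by rewrite itN => -[].
Qed.

Lemma orbit_start F C n u : orbit (rel_restrict F C) n.+1 u ->
  iter n.+1 (rel_image ((rel_restrict F C)^-1)%relation) C (u 0%N).
Proof.
elim: n u => [|n IHn] u ou; have [Fu [Cu Cv]] := ou _ (ltn0Sn _).
  by exists (u 1%N); last split.
rewrite iterS; exists (u 1%N) => //.
by apply: (IHn (fun i => u (1 + i)%N)); apply: (orbit_shift (m := 1%N)).
Qed.

End Orbits.

(** * Bounding the length of orbits *)

(** Here H stands for F_C and P for the modified relation in C.  A step of P is
    a kept step of H, an entry into Kp, or an exit from Km.  The sets U and V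
    are the complements of neighborhoods of C_+ and C_-: forward H-orbits from
    U and backward H-orbits from V are short. *)
Section NoLongOrbit.
Context {X : Type}.
Variables (P H : set (X * X)) (U V Kp Km : set X) (m n : nat).
Hypothesis P_step : forall x y, P (x, y) ->
  [\/ H (x, y) /\ (U x \/ V y), ~ Kp x /\ Kp y | Km x /\ ~ Km y].
Hypothesis Km_back : forall x y, H (x, y) -> Km y -> Km x.
Hypothesis Kp_forth : forall x y, H (x, y) -> Kp x -> Kp y.
Hypothesis Kpm : forall x, Kp x -> ~ Km x.
Hypothesis U_start : forall u, orbit H n u -> ~ U (u 0%N).
Hypothesis V_end : forall u, orbit H m u -> ~ V (u m).

Let entry x y := ~ Kp x /\ Kp y.
Let exit x y := Km x /\ ~ Km y.

(** A kept step m -> m+1 starts in U, and then the following n steps are too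
    many, or it ends in V, and then the preceding m steps are too many. *)
Lemma mixed_step u : orbit P (m + n).+1 u ->
  exists2 i, (i < (m + n).+1)%N & entry (u i) (u i.+1) \/ exit (u i) (u i.+1).
Proof.
move=> ou; apply: contrapT => noi.
have kept i : (i < (m + n).+1)%N ->
    H (u i, u i.+1) /\ (U (u i) \/ V (u i.+1)).
  move=> lti; case: (P_step (ou i lti)) => // ABi; case: noi; exists i => //.
  - by left.
  - by right.
have oH : orbit H (m + n).+1 u by move=> i /kept[].
have ltm : (m < (m + n).+1)%N by rewrite ltnS leq_addr.
have [_ [Um|Vm]] := kept _ ltm.
- have := U_start (u := fun i => u (m + i)%N); rewrite addn0; apply => //.
  by apply: orbit_shift; apply: orbit_take oH.
- have := V_end (u := fun i => u (1 + i)%N); apply => //.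
  by apply: orbit_shift; apply: orbit_take oH.
Qed.

Lemma after_entry u N i j : orbit P N u -> entry (u i) (u i.+1) ->
  (i < j)%N -> (j <= N)%N -> Kp (u j).
Proof.
move=> ou [_ Ki]; elim: j => // j IHj; rewrite ltnS leq_eqVlt.
move=> /predU1P[<-//|ltij] ltjN; have Kj := IHj ltij (ltnW ltjN).
case: (P_step (ou _ ltjN)) => [[Hj _]|[]//|[Kmj _]]; first exact: Kp_forth Hj Kj.
by case: (Kpm Kj).
Qed.

Lemma before_exit u N i j : orbit P N u -> exit (u i) (u i.+1) ->
  (j <= i)%N -> (i < N)%N -> Km (u j).
Proof.
move=> ou [Ki _] leji ltiN; rewrite -(subKn leji).
elim: (i - j)%N (leq_subr j i) => [|k IHk] leki; first by rewrite subn0.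
have Kk := IHk (ltnW leki); have e : (i - k)%N = (i - k.+1).+1 by rewrite subnSK.
have lts : (i - k.+1 < N)%N by apply: leq_ltn_trans ltiN; apply: leq_subr.
rewrite e in Kk.
case: (P_step (ou _ lts)) => [[Hj _]|[_ Kpk]|[] //]; first exact: Km_back Hj Kk.
by case: (Kpm Kpk).
Qed.

(** Cut the orbit into three runs, each of which contains an entry or an exit.
    One in the middle run is incompatible with the one in the last run if it
    is an entry, and with the one in the first run if it is an exit. *)
Lemma no_long_orbit u : ~ orbit P (3 * (m + n).+1) u.
Proof.
set L := (m + n).+1; rewrite mulSn mulSn mul1n => ou.
have o2 : orbit P L (fun i => u (L + i)%N).
  by apply: orbit_shift; apply: orbit_take ou; rewrite leq_add2l leq_addr.
have o3 : orbit P L (fun i => u (L + L + i)%N).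
  by apply: orbit_shift; apply: orbit_take ou; rewrite addnA.
have o1 : orbit P L u by apply: orbit_take ou; rewrite leq_addr.
have [j ltj [Ej|Xj]] := mixed_step o2.
- have [k ltk stepk] := mixed_step o3; rewrite addnS in Ej.
  have Kk l : (l <= L)%N -> Kp (u (L + L + l)%N).
    move=> lel; apply: (after_entry (i := (L + j)%N) ou).
    + exact: Ej.
    + by rewrite -addnA ltn_add2l; apply: leq_trans ltj (leq_addr _ _).
    + by rewrite addnA leq_add2l.
  case: stepk => -[Kpk]; first by case: Kpk; apply/Kk/ltnW.
  by case: (Kpm (Kk _ (ltnW ltk))).
- have [k ltk stepk] := mixed_step o1; rewrite addnS in Xj.
  have Kk l : (l <= L)%N -> Km (u l).
    move=> lel; apply: (before_exit (i := (L + j)%N) ou).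
    + exact: Xj.
    + by apply: leq_trans lel (leq_addr _ _).
    + by rewrite ltn_add2l; apply: leq_trans ltj (leq_addr _ _).
  case: stepk => -[Kk1 Kk2]; last by case: Kk2; apply: Kk.
  by case: (Kpm Kk2); apply: Kk.
Qed.

End NoLongOrbit.

(** * Closed relations on a compact Hausdorff space *)

Section ClosedRelations.
Context {X : topologicalType}.
Implicit Types (F : set (X * X)) (A C W : set X).

Lemma closed_relV F : closed F -> closed (F^-1)%relation.
Proof.
move: F; have /continuous_closedP : continuous (fun p : X * X => (p.2, p.1)).
  by move=> p; apply: cvg_pair => /=; [exact: cvg_snd|exact: cvg_fst].
by apply.
Qed.

Lemma closed_setX A C : closed A -> closed C -> closed (A `*` C).
Proof.
have /continuous_closedP c1 : continuous (@fst X X) by move=> p; exact: cvg_fst.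
have /continuous_closedP c2 : continuous (@snd X X) by move=> p; exact: cvg_snd.
by move=> /c1 cA /c2 cC; apply: closedI.
Qed.

Lemma closed_rel_restrict F C : closed F -> closed C -> closed (rel_restrict F C).
Proof. by move=> cF cC; apply: closedI => //; apply: closed_setX. Qed.

Hypothesis cX : compact [set: X].
Hypothesis hX : hausdorff_space X.

(** The image is the projection of a compact subset of the graph. *)
Lemma closed_rel_image F A : closed F -> closed A -> closed (rel_image F A).
Proof.
move=> cF cA.
have -> : rel_image F A = snd @` (F `&` A `*` setT).
  rewrite predeqE => y; split=> [[x Ax Fxy]|[[x z] [Fxz [/= Ax _]] /= <-]].
    by exists (x, y).
  by exists x.
apply: compact_closed => //; apply: continuous_compact.
  by apply: continuous_subspaceT => p; apply: cvg_snd.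
have cXX : compact [set: X * X] by rewrite -setXTT; apply: compact_setX.
apply: subclosed_compact (cXX) _ => //; apply: closedI => //.
by apply: closed_setX => //; exact: closedT.
Qed.

Lemma closed_iter_rel_image F A n :
  closed F -> closed A -> closed (iter n (rel_image F) A).
Proof. by move=> cF cA; elim: n => //= n; apply: closed_rel_image. Qed.

(** A closed neighborhood S of C_+ can avoid every point that orbits from D reach
    in C, when the finite set D misses C_+.  Indeed some set [stay n.+1] of points
    with an orbit of length n+1 in C already misses D; then orbits from D in C
    have length at most n, so that the set K of points they reach is a finite
    union of closed sets, and K misses [stay n.+1] too.  Normality separates the
    two.  The last clause says that S is a neighborhood of [stay n.+1], and
    hence of C_+. *)
Lemma barrier F C W D : closed F -> closed C -> open W -> C `<=` W ->
  finite_set D -> D `&` C_plus F C = set0 ->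
  exists n S K, [/\ closed S /\ S `<=` W,
    [/\ closed K, K `<=` C, D `&` C `<=` K & K `&` S = set0],
    forall x y, rel_restrict F C (x, y) -> K x -> K y &
    forall u, orbit (rel_restrict F C) n u -> S° (u 0%N)].
Proof.
move=> cF cC oW CW fD DC; set H := rel_restrict F C.
pose stay n := iter n (rel_image (H^-1)%relation) C.
have stayS n : stay n.+1 `<=` stay n.
  rewrite /stay; elim: n => [|n IHn]; first by move=> x [y _ [_ []]].
  by rewrite iterS => x [y /IHn sy xy]; exists y.
have stay_le i j : (i <= j)%N -> stay j `<=` stay i.
  move=> /subnK <-; elim: (j - i)%N => // k IHk.
  by apply: subset_trans IHk; apply: stayS.
(* The sets stay n decrease, so one index serves all points of D. *)
have [n Dn] : exists n, D `&` stay n.+1 = set0.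
  have /choice[f fP] : forall d, exists n, D d -> ~ stay n.+1 d.
    move=> d; case: (pselect (D d)) => Dd; last by exists 0%N.
    have : ~ C_plus F C d by move=> Cd; suff : set0 d by []; rewrite -DC.
    move=> /existsNP[[|k]] /not_implyP[k_gt0 dk] //; exists k => _.
    by rewrite /stay -rel_image_pow.
  have /finite_seqP[s Ds] := fD; exists (\max_(d <- s) f d).
  rewrite -subset0 => d [Dd stay_d]; apply: (fP d Dd); apply: stay_le stay_d.
  by rewrite ltnS; apply: leq_bigmax_seq; rewrite // Ds in Dd.
have cH : closed H by apply: closed_rel_restrict.
have cH' : closed (H^-1)%relation by apply: closed_relV.
pose reach i := iter i (rel_image H) (D `&` C).
have reach_sub i : reach i `<=` C.
  by case: i => [|i] y; [case|case=> x _ [_ []]].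
have reach_stay i : reach i `&` stay n.+1 = set0.
  rewrite -subset0 => x rsx.
  have [d [[Dd _] sd]] : (D `&` C) `&` iter i (rel_image (H^-1)%relation) (stay n.+1) !=set0.
    by apply/meet_iter_rel_image; exists x.
  suff : set0 d by []; rewrite -Dn; split; first exact: Dd.
  by apply: (stay_le _ (i + n.+1)%N); rewrite ?leq_addl // /stay iterD.
pose K := \bigcup_(i in `I_n.+1) reach i.
have cK : closed K.
  apply: closed_bigcup => // i _; apply: closed_iter_rel_image => //.
  by apply: closedI => //; apply: (accessible_finite_set_closed.1 (hausdorff_accessible hX)).
have cS : closed (stay n.+1) by apply: closed_iter_rel_image.
have nbhsWK : set_nbhs (stay n.+1) (W `&` ~` K).
  move=> x sx; apply: open_nbhs_nbhs; split.
    by apply: openI => //; apply: closed_openC.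
  split; first by apply/CW; apply: (stay_le 0%N) sx.
  by move=> [i _ rx]; have := reach_stay i; rewrite -subset0; apply; split; first exact: rx.
have [U nU UWK] := compact_normal hX cX cS nbhsWK.
exists n.+1, (closure U), K; split.
- by split; [exact: closed_closure|move=> x /UWK[]].
- split=> //.
  + by move=> x [i _ /reach_sub].
  + by move=> x Dx; exists 0%N.
  + by rewrite -subset0 => x [Kx /UWK[_]]; apply.
(* The next step could only leave K from reach n, but reach n.+1 is empty. *)
- move=> x y Hxy [i /= lti rx]; have ry : reach i.+1 y by exists x.
  move: lti; rewrite ltnS leq_eqVlt => /predU1P[ein|ltin]; last by exists i.+1.
  have /meet_iter_rel_image[d [[Dd _] sd]] : reach n.+1 `&` C !=set0.
    by exists y; split; [rewrite -ein|apply: reach_sub ry].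
  by suff : set0 d by []; rewrite -Dn.
- move=> u /orbit_start su; apply: (@interiorS _ U); first exact: subset_closure.
  exact: nU.
Qed.

End ClosedRelations.


(** * Finite nets in prescribed sets *)

Section MetricApproximation.
Context {R : realType} {X : metricType R}.
Implicit Types (A C Q T : set X) (r : R).

Lemma closure_ball (x : X) r : (0 < r)%R -> closure (ball x r) `<=` ball x (r + r)%R.
Proof.
move=> r0 y /(_ _ (nbhsx_ballx y r r0))[z [xz /ball_sym zy]].
exact: ball_triangle xz zy.
Qed.

(** The covering form of compactness, applied to the finite subsets of Q directed
    by inclusion: near each point of T all large enough ones do cover. *)
Lemma finite_net T Q r : compact T -> T `<=` closure Q -> (0 < r)%R ->
  exists D, [/\ finite_set D, D `<=` Q & T `<=` \bigcup_(d in D) (ball d r)°].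
Proof.
move=> cT TQ r0; have r20 : (0 < r / 2)%R by apply: divr_gt0.
pose fin := [set D | finite_set D /\ D `<=` Q].
pose bigger D := fin `&` [set D' | D `<=` D'].
have FF : Filter (filter_from fin bigger).
  apply: filter_from_filter; first by exists set0; split; [exact: finite_set0|exact: sub0set].
  move=> D D' [fD DQ] [fD' D'Q]; exists (D `|` D').
    by rewrite /fin /= finite_setU subUset.
  by move=> E [fE]; rewrite /= subUset => -[DE D'E]; split.
have covT : \forall D \near filter_from fin bigger,
    T `<=` \bigcup_(d in D) (ball d r)°.
  move: cT => /compact_near_coveringP; apply=> x Tx.
  have [d [Qd /ball_sym dx]] := TQ x Tx _ (nbhsx_ballx x _ r20).
  exists ((ball d r)°, bigger [set d]) => /=; last first.
    by move=> [y D] [/= dy [_ dD]]; exists d => //; exact: dD.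
  split.
    apply: nbhs_interior; apply/nbhs_ballP; exists (r / 2)%R => // y xy.
    by rewrite (splitr r); apply: ball_triangle dx xy.
  by exists [set d] => //; split=> // _ ->.
have [D [fD DQ] bigD] := covT; exists D; split=> //.
by apply: (bigD D); split.
Qed.

Lemma nowhere_dense_closureD C A :
  nowhere_dense_subset C A -> C `<=` closure (C `\` A).
Proof.
move=> [AC ndA] y Cy B nB; apply: contrapT => noBA.
(* A relative neighborhood of y in C contained in A would contradict ndA. *)
suff : (interior (closure (A : set (subspace C)))) y by rewrite ndA.
apply: (@interiorS (subspace C) A); first exact: subset_closure.
rewrite /interior /= -[nbhs _]/(nbhs_subspace _) -nbhs_subspace_in //.
by apply: filterS nB => z Bz Cz; apply: contrapT => nAz; apply: noBA; exists z.
Qed.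

End MetricApproximation.

(** * Replacing the steps from S to T *)

Section Surgery.
Context {R : realType} {X : metricType R}.
Hypothesis cX : compact [set: X].
Variables (F : set (X * X)) (S T D E : set X) (pre : X -> X) (r : R).
Hypotheses (cF : closed F) (sF : surjective_rel F).
Hypotheses (cS : closed S) (cT : closed T).
Hypotheses (fD : finite_set D) (fE : finite_set E).
Hypothesis r_gt0 : (0 < r)%R.
Hypothesis T_D : T `<=` \bigcup_(d in D) (ball d r)°.
Hypothesis T_E : T `<=` \bigcup_(e in E) (ball e r)°.
Hypothesis preF : forall x, F (pre x, x).

(** The three parts are the kept steps, the entries and the exits.  Interiors in
    the first part and closures of balls in the others make the relation closed:
    steps between the boundaries of S and T may be both kept and replaced. *)
Definition surgery : set (X * X) :=
  F `&` (~` S° `*` setT `|` setT `*` ~` T°)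
  `|` \bigcup_(d in D)
        ((S `&` rel_image (F^-1)%relation (T `&` closure (ball d r))) `*` [set d])
  `|` \bigcup_(e in E) ([set pre e] `*` (T `&` closure (ball e r))).

Lemma surgery_step x y : surgery (x, y) ->
  [\/ F (x, y) /\ (~ S° x \/ ~ T° y), S x /\ D y | (pre @` E) x /\ T y].
Proof.
case=> [[[Fxy [[Sx _]|[_ Ty]]]|[d Dd [[Sx _] /= ->]]]|[e Ee [/= -> [Ty _]]]].
- by constructor 1; split=> //; left.
- by constructor 1; split=> //; right.
- by constructor 2.
- by constructor 3; split=> //; exists e.
Qed.

Lemma closed_surgery : closed surgery.
Proof.
have hX := @metric_hausdorff R X.
have c1 (x : X) : closed [set x].
  by apply: (accessible_finite_set_closed.1 (hausdorff_accessible hX)).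
have cI A : closed (~` A° : set X) by apply: open_closedC; exact: open_interior.
apply: closedU; first apply: closedU.
- by apply: closedI => //; apply: closedU; apply: closed_setX => //; exact: closedT.
- apply: closed_bigcup => // d _; apply: closed_setX => //; apply: closedI => //.
  apply: closed_rel_image => //; first exact: closed_relV.
  by apply: closedI => //; exact: closed_closure.
- apply: closed_bigcup => // e _; apply: closed_setX => //; apply: closedI => //.
  exact: closed_closure.
Qed.

Lemma surgery_forward x y : F (x, y) -> exists2 z, surgery (x, z) & ball y (r + r)%R z.
Proof.
move=> Fxy; have [Sx|Sx] := pselect (S° x); last first.
  exists y; last by apply: ballxx; rewrite addr_gt0.
  by left; left; split=> //; left.
have [Ty|Ty] := pselect (T° y); last first.
  exists y; last by apply: ballxx; rewrite addr_gt0.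
  by left; left; split=> //; right.
have [d Dd dy] := T_D (interior_subset Ty).
have cdy : closure (ball d r) y by exact: subset_closure (interior_subset dy).
exists d; last by apply/ball_sym/closure_ball.
left; right; exists d => //; split=> //; split; first exact: interior_subset.
by exists y => //; split=> //; exact: interior_subset.
Qed.

Lemma surgery_backward y : exists x, surgery (x, y).
Proof.
have [Ty|Ty] := pselect (T° y); last by exists (pre y); left; left; split=> //; right.
have [e Ee ey] := T_E (interior_subset Ty).
exists (pre e); right; exists e => //; split=> //; split; first exact: interior_subset.
exact: subset_closure (interior_subset ey).
Qed.

Lemma surgery_near x z : surgery (x, z) -> exists2 y, F (x, y) & ball y (r + r)%R z.
Proof.
case=> [[[Fxz _]|[d Dd [[/= _ [y [_ dy] Fxy]] ->]]]|[e Ee [/= -> [_ ez]]]].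
- by exists z => //; apply: ballxx; rewrite addr_gt0.
- by exists y => //; apply/ball_sym/closure_ball.
- by exists e => //; apply: closure_ball.
Qed.

Lemma surjective_surgery : surjective_rel surgery.
Proof.
split; rewrite -subTset => x _; last first.
  have : rel_image (F^-1)%relation setT x by rewrite sF.2.
  by case=> y _ /surgery_forward[z xz _]; exists z.
by have [y yx] := surgery_backward x; exists y.
Qed.

End Surgery.

(** * The perturbation without long orbits *)

Theorem theorem2p58 (R : realType) (X : metricType R) (F : set (X * X))
    (C : set X) :
  compact [set: X] ->
  closed F -> surjective_rel F ->
  isolating_nbhd F C ->
  nowhere_dense_subset C (C_plus F C) ->
  nowhere_dense_subset C (C_minus F C) ->
  forall eps : R, (0 < eps)%R ->
  exists G : set (X * X),
    [/\ closed G, surjective_rel G,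
        G `<=` (V_ eps \; F)%relation /\ F `<=` (V_ eps \; G)%relation,
        exists N : nat, (0 < N)%N /\ rel_pow (rel_restrict G C) N = set0
      & [/\ C_minus G C = set0, C_plus G C = set0 & C_pm G C = set0]].
Proof.
move=> cX cF sF [cC _] nd_plus nd_minus eps eps0.
have hX := @metric_hausdorff R X.
have cpt (A : set X) : closed A -> compact A.
  by move=> cA; exact: subclosed_compact cA cX _.
pose r := (eps / 2)%R; have r0 : (0 < r)%R by apply: divr_gt0.
have /choice[pre preF] : forall x, exists y, F (y, x).
  move=> x; have : rel_image F setT x by rewrite sF.1.
  by case=> y _ Fyx; exists y.
have [E [fE EC C_E]] :=
  finite_net (cpt _ cC) (nowhere_dense_closureD nd_minus) r0.
(* If pre e were in C_-, then so would e, since e is in C. *)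
have preE_minus : (pre @` E) `&` C_plus (F^-1)%relation C = set0.
  rewrite -C_minusV -subset0 => _ [[e Ee <-] Mpre]; have [Ce] := EC e Ee.
  by apply; apply: C_minus_image Mpre Ce (preF e).
have oW : open (\bigcup_(e in E) (ball e r)°).
  by apply: bigcup_open => e _; exact: open_interior.
have [m [T [Km [[cT T_E] [cKm KmC preE_Km KmT] Km_back T_end]]]] :=
  barrier cX hX (closed_relV cF) cC oW C_E (finite_image pre fE) preE_minus.
(* Off C, points of T approximate themselves; in C they leave C_+ by density,
   and the complement of Km is a neighborhood of T. *)
have T_Q : T `<=` closure (~` (C_plus F C `|` Km)).
  move=> y Ty B nB; have nKy : ~ Km y.
    by move=> Ky; suff : set0 y by []; rewrite -KmT.
  have nBK : nbhs y (B `&` ~` Km).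
    apply: filterI => //; apply: open_nbhs_nbhs; split=> //.
    exact: closed_openC.
  have [Cy|nCy] := pselect (C y).
    have [z [[Cz nz] [Bz nKz]]] := nowhere_dense_closureD nd_plus Cy nBK.
    by exists z; split=> // -[].
  exists y; split; last exact: nbhs_singleton.
  by case=> [Py|//]; apply: nCy; exact: C_plus_sub Py.
have [D [fD DQ T_D]] := finite_net (cpt _ cT) T_Q r0.
have D_plus : D `&` C_plus F C = set0.
  by rewrite -subset0 => d [/DQ nd Pd]; apply: nd; left.
have [n [S [K [[cS _] [cK KC D_K KS] K_forth S_start]]]] :=
  barrier cX hX cF cC openT (@subsetT _ C) fD D_plus.
pose G := surgery F S T D E pre r.
have epsE : (r + r)%R = eps by rewrite -splitr.
(* Removing Km keeps the set closed under F_C-steps, as Km is closed under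
   backward ones, and it keeps D, which was chosen off Km. *)
pose Kp := K `\` Km.
have G0 : rel_pow (rel_restrict G C) (3 * (m + n).+1) = set0.
  apply: rel_pow_eq0.
  apply: (@no_long_orbit X (rel_restrict G C) (rel_restrict F C)
    (~` S°) (~` T°) Kp Km m n).
  - move=> x y [/surgery_step + [Cx Cy]].
    case=> [[Fxy ST]|[Sx Dy]|[Ex Ty]].
    + by constructor 1; split.
    + constructor 2; split; first by move=> [Kx _]; suff : set0 x by []; rewrite -KS.
      split; first exact: D_K.
      by move=> Ky; apply: (DQ y Dy); right.
    + constructor 3; split; first exact: preE_Km.
      by move=> Ky; suff : set0 y by []; rewrite -KmT.
  - by move=> x y Hxy; apply: Km_back; rewrite rel_restrictV.
  - move=> x y Hxy [Kx nKx]; split; first exact: K_forth Hxy Kx.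
    by move=> Ky; apply: nKx; apply: Km_back Ky; rewrite rel_restrictV.
  - by move=> x [].
  - by move=> u /S_start Su; apply.
  (* T was obtained for F^-1, so the orbit is read backward. *)
  - move=> u ou; have := T_end (fun i => u (m - i)%N).
    rewrite subn0 => H; apply; apply: H => i ltim.
    rewrite rel_restrictV /=.
    have := ou (m - i.+1)%N; rewrite subnSK //; apply.
    exact: leq_subr.
have [Gm Gp] := nilpotent_limit_sets (N := 3 * (m + n).+1) isT G0.
exists G; split.
- exact: closed_surgery.
- exact: surjective_surgery.
- split=> -[x y].
  + case/(surgery_near r0 preF) => z Fxz yz; exists z => //.
    by move: yz; rewrite epsE ballEmdist.
  + move=> Fxy; have [z Gxz yz] := surgery_forward S E pre r0 T_D Fxy; exists z => //.
    by move: yz; rewrite epsE /V_ /= metric_sym ballEmdist.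
- by exists (3 * (m + n).+1)%N.
- by split=> //; rewrite /C_pm Gm setI0.
Qed.
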